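(* Let $r,s,t$ be odd integers with $r\in\{55,57,\ldots,125\}$ (the odd integers from $55$ to $125$) and $s,t\in\{75,85,95,105,115,125\}$, such that $K_{r,s,t}$ satisfies the necessary conditions. Then $K_{r,s,t}$ has a decomposition into $5$-cycles.
   Context: $K_{r,s,t}$ denotes the complete tripartite graph with parts of sizes $r,s,t$. A decomposition of a graph into $5$-cycles is a partition of its edge set into edge sets of cycles of length $5$. The graph $K_{r,s,t}$ is said to satisfy the necessary conditions if: (i) $5\mid rs+rt+st$; (ii) $r\equiv s\equiv t \pmod 2$; (iii) when the three part sizes are listed as $x\le y\le z$, one has $z\le 4xy/(x+y)$. *)

(* Defs.v *)
From mathcomp Require Import all_boot all_algebra.

Set Implicit Arguments.
Unset Strict Implicit.
Unset Printing Implicit Defensive.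

(* A finite simple graph is a symmetric irreflexive relation on a finType. *)

Definition edge_set (T : finType) (e : rel T) : {set {set T}} :=
  [set [set x; y] | x in T, y in e x].

Definition cycle_edges (T : finType) (c : seq T) : {set {set T}} :=
  [set [set x; next c x] | x in c].

Definition is_5cycle (T : finType) (e : rel T) (B : {set {set T}}) : Prop :=
  exists c : seq T, [/\ size c = 5, ucycle e c & B = cycle_edges c].

Definition has_5cycle_decomposition (T : finType) (e : rel T) : Prop :=
  exists2 P : {set {set {set T}}},
    partition P (edge_set e) & forall B, B \in P -> is_5cycle e B.

Section CompleteTripartite.

Variables r s t : nat.

Definition tripartite_vertex : finType := ('I_r + 'I_s + 'I_t)%type.

Definition tripartite_part (v : tripartite_vertex) : nat :=
  match v with
  | inl (inl _) => 0
  | inl (inr _) => 1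
  | inr _ => 2
  end.

Definition complete_tripartite : rel tripartite_vertex :=
  [rel u v | tripartite_part u != tripartite_part v].

Lemma complete_tripartite_sym : symmetric complete_tripartite.
Proof. by move=> u v; congr negb; apply: eq_sym. Qed.

Lemma complete_tripartite_irrefl : irreflexive complete_tripartite.
Proof. by move=> u; apply: negbTE; rewrite negbK. Qed.

Definition necessary_conditions : Prop :=
  [/\ 5 %| r * s + r * t + s * t,
      r = s %[mod 2] /\ s = t %[mod 2]
    & forall x y z : nat, perm_eq [:: x; y; z] [:: r; s; t] ->
        x <= y -> y <= z ->
        (z%:R <= 4%:R * x%:R * y%:R / (x%:R + y%:R) :> rat)%R].

End CompleteTripartite.

Arguments complete_tripartite r s t : clear implicits.

(* Main.v *)
Require Import Defs.
From mathcomp Require Import all_boot all_algebra.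

(** The main tool is composition along a Latin square.  Cut each of the three
    parts of K_{r,s,t} into n pieces.  The square with entry i + j mod n at
    (i, j) selects n^2 triples of pieces (i, j, i + j) such that every pair of
    pieces from two different parts lies in exactly one triple.  Hence the edges
    of K_{r,s,t} are partitioned into n^2 smaller complete tripartite graphs,
    and decompositions of these combine ([latin_composition]).

    With n = 5 the numbers s and t are sums of five terms in {15, 25}, and r is
    a sum of five terms in {11, 13, 23, 25}: writing r = 55 + 2 (6 q + m) with
    m and q at most 5, start from five terms equal to 11, add 12 to q of them
    and 2 to m of them ([odd_five_parts]).  So twelve small graphs suffice, up
    to exchanging parts ([decomposable_blocks]).  Composition again, with n = 3
    or n = 5, reduces six of them to K_{w,5,5} with w in {3, 5, 7, 9}.  Explicit
    tables, checked by computation, decompose these four and the six that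
    remain: K_{w,25,25} for w in {11, 13}, where w is smaller than five times 3,
    and K_{w,15,25} for w in {11, 13, 23, 25}, where the last two parts would
    need different numbers of pieces of size 5.

    The combinatorics is done with closed walks of length 5 rather than cycles,
    and the three parts are arbitrary lists in an arbitrary type.  Such families
    can be relabelled and united without injectivity or disjointness conditions.
    The return to cycles costs nothing: in a graph without loops a closed 5-walk
    that repeats no edge is a cycle ([closed_5walk_cycle]). *)

Set Implicit Arguments.
Unset Strict Implicit.
Unset Printing Implicit Defensive.

(** * Walk decompositions and Latin squares *)

Definition steps (V : Type) (c : seq V) : seq (V * V) := zip c (rot 1 c).

(** For symmetric [f] this is the sum of [f] over the edges of the complete
    tripartite graph on [A], [B], [C]; entries are counted with multiplicity. *)
Definition edge_weight (V : Type) (f : V -> V -> nat) (A B C : seq V) : nat :=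
  \sum_(a <- A) \sum_(b <- B) f a b + \sum_(b <- B) \sum_(c <- C) f b c
  + \sum_(c <- C) \sum_(a <- A) f c a.

(** An edge is an unordered pair, and two multisets of edges agree exactly when
    all symmetric functions have the same sum over them.  Stated in this way the
    notion is stable under any map of the vertices and under unions. *)
Definition decomposes (V : Type) (cs : seq (seq V)) (A B C : seq V) : Prop :=
  all (fun c => size c == 5) cs /\
  forall f : V -> V -> nat, (forall x y, f x y = f y x) ->
    \sum_(c <- cs) \sum_(p <- steps c) f p.1 p.2 = edge_weight f A B C.

(** Quantifying over all lists of the given lengths makes relabelling part of the
    notion, so a block of a larger graph is an instance. *)
Definition decomposable (r s t : nat) : Prop :=
  forall (V : Type) (A B C : seq V), size A = r -> size B = s -> size C = t ->
    exists cs, decomposes cs A B C.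

Lemma decomposable_swap r s t : decomposable r s t -> decomposable r t s.
Proof.
move=> dec V A B C sA sB sC; have [cs [cs5 csE]] := dec V A C B sA sC sB.
exists cs; split=> // f fC; rewrite csE // /edge_weight.
have sw X Y : \sum_(x <- X) \sum_(y <- Y) f x y =
              \sum_(y <- Y) \sum_(x <- X) f y x.
  by rewrite exchange_big; do 2!apply: eq_bigr => ? _.
by rewrite (sw A C) (sw C B) (sw B A) addnC [X in _ + X]addnC addnA.
Qed.

Lemma sum_reshape (V : Type) (sh : seq nat) n (A : seq V) (g : V -> nat) :
    size sh = n -> size A = sumn sh ->
  \sum_(a <- A) g a = \sum_(i < n) \sum_(a <- nth [::] (reshape sh A) i) g a.
Proof.
move=> szsh szA; rewrite -{1}(reshapeKr (sh := sh) (s := A)) ?szA // big_flatten /=.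
by rewrite (big_nth [::]) size_reshape szsh big_mkord.
Qed.

Lemma size_nth_reshape (V : Type) (sh : seq nat) (A : seq V) i :
  size A = sumn sh -> size (nth [::] (reshape sh A) i) = nth 0 sh i.
Proof.
move=> szA; have := reshapeKl (sh := sh) (s := A); rewrite szA => /(_ (leqnn _)).
move/(congr1 (fun l => nth 0 l i)) <-.
case: (ltnP i (size sh)) => lt_i; first by rewrite (nth_map [::]) ?size_reshape.
by rewrite !nth_default ?size_map ?size_reshape.
Qed.

(** Each of the three kinds of edges is summed over all pairs of pieces: for
    fixed [j] the map [i |-> i + j] is a bijection of Z/n, and likewise for fixed
    [i], so the third piece of the triple runs once over all pieces of its part
    when either index varies. *)
Lemma latin_composition n (rs ss ts : seq nat) :
    size rs = n -> size ss = n -> size ts = n ->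
    {in rs & ss & ts, forall a b c, decomposable a b c} ->
  decomposable (sumn rs) (sumn ss) (sumn ts).
Proof.
case: n => [|n] szr szs szt dec V A B C szA szB szC.
  rewrite (size0nil szr) in szA; rewrite (size0nil szs) in szB.
  rewrite (size0nil szt) in szC; exists [::]; split=> // f _.
  by rewrite /edge_weight (size0nil szA) (size0nil szB) (size0nil szC) !big_nil.
pose pA (i : 'I_n.+1) := nth [::] (reshape rs A) i.
pose pB (i : 'I_n.+1) := nth [::] (reshape ss B) i.
pose pC (i : 'I_n.+1) := nth [::] (reshape ts C) i.
have [cs csP] : exists cs : 'I_n.+1 * 'I_n.+1 -> seq (seq V),
    forall ij, decomposes (cs ij) (pA ij.1) (pB ij.2) (pC (ij.1 + ij.2)%R).
  apply: (@fin_all_exists _ _ (fun ij cs =>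
    decomposes cs (pA ij.1) (pB ij.2) (pC (ij.1 + ij.2)%R))).
  move=> -[i j] /=.
  apply: (dec (nth 0 rs i) (nth 0 ss j) (nth 0 ts (i + j)%R));
    by rewrite ?size_nth_reshape // mem_nth ?szr ?szs ?szt.
exists (flatten [seq cs ij | ij <- enum {: 'I_n.+1 * 'I_n.+1}]); split.
  elim: (enum _) => //= ij l IHl; rewrite all_cat IHl andbT.
  by have [] := csP ij.
move=> f fC; rewrite big_flatten big_map /= big_enum /=.
rewrite (eq_bigr (fun ij =>
    edge_weight f (pA ij.1) (pB ij.2) (pC (ij.1 + ij.2)%R))); last first.
  by move=> ij _; have [_ ->] := csP ij.
rewrite -(pair_bigA _
  (fun i j => edge_weight f (pA i) (pB j) (pC (i + j)%R))) /=.
have split_sum sh1 sh2 (X Y : seq V) : size sh1 = n.+1 -> size sh2 = n.+1 ->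
    size X = sumn sh1 -> size Y = sumn sh2 ->
    \sum_(x <- X) \sum_(y <- Y) f x y = \sum_(i < n.+1) \sum_(j < n.+1)
      \sum_(x <- nth [::] (reshape sh1 X) i)
      \sum_(y <- nth [::] (reshape sh2 Y) j) f x y.
  move=> sz1 sz2 szX szY; rewrite (sum_reshape _ sz1 szX); apply: eq_bigr => i _.
  rewrite [RHS]exchange_big /=; apply: eq_bigr => x _; exact: sum_reshape.
under eq_bigr => i _ do rewrite /edge_weight big_split big_split /=.
rewrite 2!big_split /= /edge_weight; congr (_ + _ + _).
- by rewrite (split_sum rs ss).
- rewrite (split_sum ss ts) // exchange_big /=; apply: eq_bigr => j _.
  by rewrite [RHS](reindex_inj (GRing.addIr j)).
rewrite (split_sum ts rs) // [RHS]exchange_big /=; apply: eq_bigr => i _.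
by rewrite [RHS](reindex_inj (GRing.addrI i)).
Qed.

(** * Certificates *)

Definition lex_le (p q : nat * nat) : bool :=
  if p.1 == q.1 then p.2 <= q.2 else p.1 <= q.1.

(** A normal form of a multiset of unordered pairs. *)
Definition sorted_edges (E : seq (nat * nat)) : seq (nat * nat) :=
  sort lex_le [seq (minn p.1 p.2, maxn p.1 p.2) | p <- E].

(** The vertices of K_{r,s,t} are numbered consecutively: first the part of size
    [r], then the part of size [s], then the part of size [t]. *)
Definition certifies (r s t : nat) (cs : seq (seq nat)) : bool :=
  let A := iota 0 r in let B := iota r s in let C := iota (r + s) t in
  all (fun c => size c == 5) cs &&
  (sorted_edges (flatten [seq steps c | c <- cs]) ==
   sorted_edges ([seq (a, b) | a <- A, b <- B] ++ [seq (b, c) | b <- B, c <- C]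
                 ++ [seq (c, a) | c <- C, a <- A])).

Lemma sorted_edges_sum (f : nat -> nat -> nat) (E F : seq (nat * nat)) :
    (forall x y, f x y = f y x) -> sorted_edges E = sorted_edges F ->
  \sum_(p <- E) f p.1 p.2 = \sum_(p <- F) f p.1 p.2.
Proof.
move=> fC eqEF.
have normE G : \sum_(p <- G) f p.1 p.2 = \sum_(p <- sorted_edges G) f p.1 p.2.
  rewrite /sorted_edges (perm_big _ (permEl (perm_sort _ _))) big_map /=.
  by apply: eq_bigr => -[x y] _ /=; case: leqP => _.
by rewrite normE eqEF -normE.
Qed.

(** Any three lists of lengths [r], [s], [t] are the images of the three intervals
    of numbers under one map, namely indexing into their concatenation; the table
    of walks is carried along this map.  Positivity of [r] provides the default
    vertex for the indexing. *)
Lemma certifies_decomposable r s t cs :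
  0 < r -> certifies r s t cs -> decomposable r s t.
Proof.
move=> r_gt0 /andP[cs5 /eqP eqE] V A B C szA szB szC.
case: A szA => [|x0 A'] szA; first by rewrite -szA in r_gt0.
move: (x0 :: A') szA => A szA {A'}; pose D := A ++ B ++ C; pose h := nth x0 D.
have szD : size D = r + s + t by rewrite !size_cat szA szB szC addnA.
have imA : A = map h (iota 0 r).
  by rewrite map_nth_iota0 ?szD -?addnA ?leq_addr // -szA take_size_cat.
have imB : B = map h (iota r s).
  rewrite map_nth_iota ?szD -?addnA ?addKn ?leq_addr //.
  by rewrite -szA -szB drop_size_cat // take_size_cat.
have imC : C = map h (iota (r + s) t).
  rewrite map_nth_iota ?szD ?addKn // -szA -szB -szC -size_cat /D catA.
  by rewrite drop_size_cat // take_size.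
exists [seq map h c | c <- cs]; split.
  by rewrite all_map; apply: sub_all cs5 => c /=; rewrite size_map.
move=> f fC; rewrite imA imB imC /edge_weight big_map.
have steps_map c : steps (map h c) = [seq (h p.1, h p.2) | p <- steps c].
  rewrite /steps -map_rot; elim: c (rot 1 c) => [|x c IHc] [|y d] //=.
  by rewrite IHc.
under eq_bigr => c _ do rewrite steps_map big_map /=.
have := sorted_edges_sum (f := fun x y => f (h x) (h y)) (fun x y => fC _ _) eqE.
rewrite big_flatten big_map => ->.
rewrite !big_cat !big_allpairs /= addnA.
by congr (_ + _ + _); rewrite big_map; apply: eq_bigr => x _; rewrite big_map.
Qed.

(** * From walks to cycles *)

Definition walk_edges (T : finType) (c : seq T) : seq {set T} :=
  [seq [set p.1; p.2] | p <- steps c].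

Lemma steps_next (T : eqType) (c : seq T) :
  uniq c -> steps c = [seq (x, next c x) | x <- c].
Proof.
case: c => // y p Up; rewrite /steps rot1_cons.
apply: (@eq_from_nth _ (y, y)) => [|i].
  by rewrite size_map size_zip size_rcons minnn.
rewrite size_zip size_rcons minnn => lt_i.
rewrite nth_zip ?size_rcons // (nth_map y) // next_nth mem_nth // index_uniq //.
congr pair; rewrite nth_rcons if_same; case: ltnP => // ?.
by rewrite nth_default.
Qed.

Lemma pair_set_eq (T : finType) (x y u v : T) :
  [set x; y] = [set u; v] -> (x, y) = (u, v) \/ (x, y) = (v, u).
Proof.
move=> eqS.
have: x \in [set u; v] by rewrite -eqS set21.
have: y \in [set u; v] by rewrite -eqS set22.
have: u \in [set x; y] by rewrite eqS set21.
have: v \in [set x; y] by rewrite eqS set22.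
rewrite !in_set2.
by do 4![case/orP=> /eqP ?]; subst; by [left | right].
Qed.

Lemma mem_edge_set (T : finType) (e : rel T) (x y : T) :
  symmetric e -> ([set x; y] \in edge_set e) = e x y.
Proof.
move=> e_sym; apply/imset2P/idP => [[u v _ e_uv /pair_set_eq[] [-> ->]] | e_xy].
- exact: e_uv.
- by rewrite e_sym; apply: e_uv.
by exists x y.
Qed.

Lemma uniq_flatten_inj (T : eqType) (ss : seq (seq T)) (s1 s2 : seq T) (x : T) :
    uniq (flatten ss) -> s1 \in ss -> s2 \in ss -> x \in s1 -> x \in s2 ->
  s1 = s2.
Proof.
elim: ss => //= s ss IHss; rewrite cat_uniq => /and3P[_ /hasPn dis U].
have out s' : s' \in ss -> x \in s' -> x \notin s.
  by move=> ss_s' s'x; apply: dis; apply/flattenP; exists s'.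
rewrite !inE => /predU1P[->|ss1] /predU1P[->|ss2] //.
- by move=> sx /(out _ ss2); rewrite sx.
- by move=> /(out _ ss1) /negbTE->.
exact: IHss.
Qed.

(** Two positions on the walk are one or two steps apart.  If they carry the same
    vertex, then in the first case the step is a loop, and in the second case the
    two steps between them traverse the same edge. *)
Lemma closed_5walk_cycle (T : finType) (e : rel T) (c : seq T) :
    symmetric e -> irreflexive e -> size c = 5 ->
    uniq (walk_edges c) -> {subset walk_edges c <= edge_set e} ->
  ucycle e c /\ cycle_edges c =i walk_edges c.
Proof.
move=> e_sym e_irr sz5 Ue sub_e.
have adj p : p \in steps c -> e p.1 p.2.
  by move=> c_p; rewrite -mem_edge_set // sub_e //; apply: map_f.
suff Uc : uniq c.
  split; last first.
    move=> B; rewrite /walk_edges steps_next // -map_comp.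
    by apply/imsetP/mapP => -[x c_x ->]; exists x.
  rewrite /ucycle Uc andbT; move: sz5 adj {sub_e Ue Uc}.
  case: c => [|a [|b [|c [|d [|f [|? ?]]]]]] // _ adj.
  by rewrite /= !(adj (_, _)) // !inE eqxx ?orbT.
have neq_adj x y : (x, y) \in steps c -> x != y.
  by move/adj => /=; apply: contraTneq => ->; rewrite e_irr.
move: sz5 Ue neq_adj {sub_e adj}.
case: c => [|a [|b [|c [|d [|f [|? ?]]]]]] // _ Ue neq_adj.
have neq2 x y z : [set x; y] != [set y; z] :> {set T} -> x != z.
  by apply: contra_neq => ->; rewrite setUC.
move: Ue; rewrite /walk_edges /= !inE !negb_or -!andbA.
case/and5P=> n1 _ _ n5 /and5P[n2 _ _ n3 /and3P[_ n4 _]].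
rewrite eq_sym in n5.
rewrite andbT (neq2 _ _ _ n1) (neq2 _ _ _ n2) (neq2 _ _ _ n3).
rewrite [a == d]eq_sym (neq2 _ _ _ n4) [b == f]eq_sym (neq2 _ _ _ n5).
by rewrite [a == f]eq_sym !neq_adj // /steps /= !inE eqxx ?orbT.
Qed.

Lemma decomposition_of_walks (T : finType) (e : rel T) (cs : seq (seq T)) :
    symmetric e -> irreflexive e -> all (fun c => size c == 5) cs ->
    uniq (flatten (map (@walk_edges T) cs)) ->
    flatten (map (@walk_edges T) cs) =i edge_set e ->
  has_5cycle_decomposition e.
Proof.
move=> e_sym e_irr cs5 U memE.
have csP c : c \in cs -> ucycle e c /\ cycle_edges c =i walk_edges c.
  move=> cs_c; apply: closed_5walk_cycle => //.
  - exact/eqP/(allP cs5).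
  - have /perm_uniq := perm_flatten (perm_map (@walk_edges T) (perm_to_rem cs_c)).
    by rewrite U /= cat_uniq => /esym/and3P[].
  by move=> B c_B; rewrite -memE; apply/flatten_mapP; exists c.
exists [set B | B \in [seq cycle_edges c | c <- cs]]; last first.
  move=> B; rewrite inE => /mapP[c cs_c ->].
  by exists c; split=> //; [apply/eqP/(allP cs5) | have [] := csP c cs_c].
apply/and3P; split.
- apply/eqP/setP => B; rewrite -memE.
  apply/bigcupP/flatten_mapP => [[D]|[c cs_c c_B]].
    rewrite inE => /mapP[c cs_c ->]; have [_ ->] := csP c cs_c.
    by exists c.
  exists (cycle_edges c); first by rewrite inE; apply: map_f.
  by have [_ ->] := csP c cs_c.
- apply/trivIsetP => D1 D2; rewrite !inE => /mapP[c1 cs1 ->] /mapP[c2 cs2 ->].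
  have [_ E1] := csP c1 cs1; have [_ E2] := csP c2 cs2.
  apply: contraR => /pred0Pn[B /andP[/=]]; rewrite E1 E2 => B1 B2.
  apply/eqP/setP => B'; rewrite E1 E2.
  by rewrite (uniq_flatten_inj U _ _ B1 B2) ?map_f.
rewrite inE; apply/mapP => -[c cs_c c0]; have [_ E] := csP c cs_c.
have := allP cs5 c cs_c; case: c c0 E {cs_c} => // x c c0 E _.
have: walk_edges (x :: c) = [::].
  by case: walk_edges E => // B l /(_ B); rewrite -c0 !inE eqxx.
by case: c {c0 E}.
Qed.

Lemma decomposable_tripartite r s t :
  decomposable r s t -> has_5cycle_decomposition (complete_tripartite r s t).
Proof.
set T := tripartite_vertex r s t => dec.
pose A : seq T := [seq inl (inl i) | i <- enum 'I_r].
pose B : seq T := [seq inl (inr i) | i <- enum 'I_s].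
pose C : seq T := [seq inr i | i <- enum 'I_t].
have [||| cs [cs5 csE]] := dec T A B C; try by rewrite size_map size_enum_ord.
pose E := [seq (a, b) | a <- A, b <- B] ++ [seq (b, c) | b <- B, c <- C]
            ++ [seq (c, a) | c <- C, a <- A].
have permE : perm_eq (flatten (map (@walk_edges T) cs))
                     [seq [set p.1; p.2] | p <- E].
  (* Indicators of sets of edges are symmetric functions of the two ends. *)
  apply/permP => a.
  have countE (l : seq {set T}) : count a l = \sum_(D <- l) a D.
    by rewrite -sum1_count big_mkcond.
  rewrite !countE big_flatten !big_map !big_cat !big_allpairs /= addnA.
  rewrite -[RHS](csE (fun x y => a [set x; y])) => [|x y]; last by rewrite setUC.
  by apply: eq_bigr => c _; rewrite big_map.
have UA : uniq A by rewrite map_inj_uniq ?enum_uniq // => ? ? [].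
have UB : uniq B by rewrite map_inj_uniq ?enum_uniq // => ? ? [].
have UC : uniq C by rewrite map_inj_uniq ?enum_uniq // => ? ? [].
have memA v : (v \in A) = (tripartite_part v == 0).
  apply/mapP/eqP => [[i _ ->] // |]; case: v => [[i|i]|i] // _.
  by exists i; rewrite ?mem_enum.
have memB v : (v \in B) = (tripartite_part v == 1).
  apply/mapP/eqP => [[i _ ->] // |]; case: v => [[i|i]|i] // _.
  by exists i; rewrite ?mem_enum.
have memC v : (v \in C) = (tripartite_part v == 2).
  apply/mapP/eqP => [[i _ ->] // |]; case: v => [[i|i]|i] // _.
  by exists i; rewrite ?mem_enum.
have pairE (X Y : seq T) x y :
    ((x, y) \in [seq (u, v) | u <- X, v <- Y]) = (x \in X) && (y \in Y).
  apply/allpairsP/andP => [[[u v] [? ? [-> ->]]] // | [Xx Yy]].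
  by exists (x, y).
(* Edges are listed with their ends in cyclic order of the parts, so distinct
   listed pairs are distinct edges. *)
have memE x y :
    ((x, y) \in E) = (tripartite_part y == (tripartite_part x).+1 %% 3).
  rewrite !mem_cat !pairE !memA !memB !memC.
  by case: x => [[?|?]|?]; case: y => [[?|?]|?].
have UE : uniq E.
  have pairsU (X Y : seq T) :
      uniq X -> uniq Y -> uniq [seq (u, v) | u <- X, v <- Y].
    by move=> UX UY; apply: allpairs_uniq => // -[? ?] [? ?] _ _ [-> ->].
  rewrite !cat_uniq !pairsU // andbT andTb.
  apply/andP; split; apply/hasPn => -[x y]; rewrite ?mem_cat !pairE !memA !memB !memC;
    by case: x => [[?|?]|?]; case: y => [[?|?]|?].
apply: (decomposition_of_walks (cs := cs)) => //.
- exact: complete_tripartite_sym.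
- exact: complete_tripartite_irrefl.
- rewrite (perm_uniq permE) map_inj_in_uniq // => -[x y] [u v]; rewrite !memE.
  move=> /eqP xy /eqP uv /pair_set_eq[] // [xv yu]; move: xy uv; rewrite xv yu => ->.
  by case: (v) => [[?|?]|?].
move=> D; rewrite (perm_mem permE).
apply/mapP/imset2P=> [[[x y] Exy ->] | [x y _ xy ->]].
  exists x y => //; move: Exy; rewrite memE => /eqP xy.
  by rewrite unfold_in /= xy; case: (x) => [[?|?]|?].
have: ((x, y) \in E) || ((y, x) \in E).
  by rewrite !memE; move: xy; case: x => [[?|?]|?]; case: y => [[?|?]|?].
by case/orP=> ?; [exists (x, y) | exists (y, x); rewrite //= setUC].
Qed.

(** * Small complete tripartite graphs *)

(** A 5-cycle in a tripartite graph has two vertices in each of two parts and one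
    in the third; each walk in these tables starts at the latter. *)
Definition walks_3_5_5 : seq (seq nat) := [::
  [::0;3;10;5;8]; [::0;5;12;3;9]; [::0;7;12;6;10]; [::1;3;8;4;10];
  [::1;6;9;4;12]; [::2;3;11;7;10]; [::2;7;9;5;11]; [::6;2;12;0;11];
  [::7;1;9;2;8]; [::8;1;4;0;6]; [::11;1;5;2;4]].

Lemma decomposable_3_5_5 : decomposable 3 5 5.
Proof. by apply: (@certifies_decomposable _ _ _ walks_3_5_5); vm_compute. Qed.

Definition walks_5_5_5 : seq (seq nat) := [::
  [::2;5;14;8;12]; [::3;6;13;8;11]; [::3;9;14;7;13]; [::4;5;10;9;13];
  [::4;9;11;7;12]; [::5;0;13;1;11]; [::5;1;14;3;12]; [::6;2;10;1;12];
  [::7;2;11;4;10]; [::9;2;14;0;12]; [::10;0;9;1;6]; [::10;3;7;1;8];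
  [::11;0;8;4;6]; [::13;2;8;3;5]; [::14;4;7;0;6]].

Lemma decomposable_5_5_5 : decomposable 5 5 5.
Proof. by apply: (@certifies_decomposable _ _ _ walks_5_5_5); vm_compute. Qed.

Definition walks_7_5_5 : seq (seq nat) := [::
  [::2;7;13;10;16]; [::3;11;12;7;16]; [::5;9;15;8;12]; [::7;3;15;1;14];
  [::7;5;13;4;15]; [::8;0;12;2;13]; [::8;5;15;6;14]; [::8;6;12;1;16];
  [::9;2;14;3;13]; [::11;0;16;5;14]; [::11;1;13;6;16]; [::12;3;10;6;9];
  [::12;4;11;2;10]; [::13;0;10;5;11]; [::14;0;9;4;10]; [::14;4;7;1;9];
  [::15;0;7;6;11]; [::15;2;8;1;10]; [::16;4;8;3;9]].

Lemma decomposable_7_5_5 : decomposable 7 5 5.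
Proof. by apply: (@certifies_decomposable _ _ _ walks_7_5_5); vm_compute. Qed.

Definition walks_9_5_5 : seq (seq nat) := [::
  [::7;10;17;12;18]; [::9;1;15;5;14]; [::10;1;14;3;16]; [::10;5;16;2;14];
  [::10;8;18;4;15]; [::11;5;17;7;15]; [::11;7;14;0;17]; [::11;8;17;4;14];
  [::12;6;15;8;14]; [::13;1;17;6;14]; [::13;6;18;0;15]; [::13;7;16;1;18];
  [::15;2;13;8;12]; [::15;3;10;4;9]; [::16;0;9;2;11]; [::16;4;12;5;9];
  [::16;6;11;1;12]; [::16;8;9;3;13]; [::17;2;10;6;9]; [::17;3;11;4;13];
  [::18;2;12;0;11]; [::18;3;12;7;9]; [::18;5;13;0;10]].

Lemma decomposable_9_5_5 : decomposable 9 5 5.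
Proof. by apply: (@certifies_decomposable _ _ _ walks_9_5_5); vm_compute. Qed.

Definition walks_11_15_25 : seq (seq nat) := [::
  [::0;13;40;24;44]; [::0;14;41;20;29]; [::0;16;36;23;45]; [::0;18;37;20;46];
  [::0;19;29;23;41]; [::0;20;49;21;26]; [::0;21;30;24;50]; [::0;22;39;14;35];
  [::0;23;39;25;31]; [::0;24;28;21;40]; [::1;12;46;13;29]; [::1;13;37;22;31];
  [::1;14;30;23;43]; [::1;15;27;13;48]; [::1;16;46;14;49]; [::1;18;43;22;46];
  [::1;19;40;16;50]; [::1;20;35;17;28]; [::1;22;36;19;35]; [::2;12;39;17;42];
  [::2;14;28;25;40]; [::2;15;46;17;48]; [::2;18;30;20;38]; [::2;20;45;16;27];
  [::2;21;32;18;46]; [::2;22;45;13;34]; [::2;24;26;13;39]; [::3;11;48;18;36];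
  [::3;13;38;11;32]; [::3;15;37;11;47]; [::3;16;26;14;40]; [::3;17;31;11;43];
  [::3;18;40;22;34]; [::3;19;28;23;35]; [::3;20;33;23;31]; [::3;23;48;14;37];
  [::3;24;47;18;41]; [::4;12;38;23;32]; [::4;13;35;12;49]; [::4;14;43;20;50];
  [::4;15;40;11;41]; [::4;18;33;13;30]; [::4;19;31;21;48]; [::4;20;32;16;31];
  [::4;21;42;12;26]; [::4;22;48;15;43]; [::4;23;26;15;47]; [::4;24;41;12;40];
  [::5;11;26;19;47]; [::5;12;30;16;35]; [::5;13;49;15;38]; [::5;15;39;16;34];
  [::5;19;39;20;31]; [::5;20;36;12;27]; [::5;22;38;24;49]; [::5;23;34;21;45];
  [::5;24;34;12;29]; [::5;25;27;22;26]; [::6;11;42;24;48]; [::6;12;50;21;39];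
  [::6;14;45;25;41]; [::6;18;45;17;26]; [::6;19;50;22;47]; [::6;21;44;11;36];
  [::6;22;41;19;49]; [::6;23;44;14;32]; [::6;24;31;13;44]; [::6;25;42;22;30];
  [::7;11;27;14;33]; [::7;12;33;19;38]; [::7;13;50;11;39]; [::7;14;31;12;37];
  [::7;15;29;16;44]; [::7;16;43;13;36]; [::7;18;34;20;27]; [::7;21;29;18;26];
  [::7;22;49;23;46]; [::7;25;43;19;45]; [::8;11;33;15;31]; [::8;12;28;15;34];
  [::8;14;34;17;38]; [::8;15;30;19;44]; [::8;16;42;15;36]; [::8;18;27;24;46];
  [::8;19;34;11;28]; [::8;22;44;25;35]; [::8;24;35;15;50]; [::8;25;36;21;27];
  [::9;11;46;19;37]; [::9;14;29;25;50]; [::9;16;47;12;43]; [::9;19;48;25;49];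
  [::9;20;44;18;35]; [::9;21;33;24;39]; [::9;23;47;20;40]; [::9;24;37;21;38];
  [::10;12;32;24;36]; [::10;15;32;22;35]; [::10;16;49;18;28];
  [::10;17;50;18;42]; [::10;18;38;16;33]; [::10;19;42;14;50];
  [::10;21;41;17;37]; [::10;22;33;25;34]; [::10;23;27;17;44];
  [::10;24;43;17;30]; [::11;0;27;6;29]; [::11;1;44;9;30]; [::11;2;30;7;35];
  [::11;4;46;3;45]; [::11;10;43;7;49]; [::12;0;43;2;44]; [::12;3;33;9;48];
  [::12;9;42;6;45]; [::13;2;26;8;42]; [::13;6;38;10;47]; [::13;8;29;10;41];
  [::13;9;47;7;32]; [::13;10;27;9;28]; [::14;3;26;1;38]; [::14;5;33;1;36];
  [::14;10;49;8;47]; [::15;0;36;5;41]; [::15;6;43;5;44]; [::15;9;34;1;45];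
  [::16;2;33;8;37]; [::16;4;44;3;28]; [::16;5;42;0;48]; [::16;6;50;2;41];
  [::17;0;28;6;40]; [::17;1;41;8;32]; [::17;5;37;6;33]; [::17;6;35;2;47];
  [::17;7;34;4;36]; [::17;8;39;0;49]; [::17;9;36;2;29]; [::18;5;28;2;31];
  [::18;9;46;5;39]; [::19;7;29;9;32]; [::20;6;31;7;28]; [::20;7;41;9;26];
  [::20;8;40;7;42]; [::20;10;32;5;48]; [::21;1;42;4;35]; [::21;3;30;8;43];
  [::21;5;30;0;47]; [::21;8;48;10;46]; [::22;3;39;4;28]; [::22;9;45;4;29];
  [::23;1;27;3;50]; [::23;2;49;3;42]; [::23;7;50;5;40]; [::23;8;45;2;37];
  [::24;1;40;10;45]; [::24;7;48;3;29]; [::25;0;34;6;46]; [::25;1;37;0;38];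
  [::25;2;32;1;47]; [::25;3;38;4;37]; [::25;4;33;0;32]; [::25;9;31;10;26];
  [::25;10;39;1;30]; [::27;4;17;2;19]].

Lemma decomposable_11_15_25 : decomposable 11 15 25.
Proof. by apply: (@certifies_decomposable _ _ _ walks_11_15_25); vm_compute. Qed.

Definition walks_13_15_25 : seq (seq nat) := [::
  [::0;13;33;25;47]; [::0;14;44;18;32]; [::0;16;42;14;50]; [::0;20;45;25;35];
  [::0;21;29;18;33]; [::0;22;52;16;34]; [::0;27;28;25;46]; [::1;13;47;24;34];
  [::1;15;34;23;33]; [::1;17;45;27;52]; [::1;18;31;19;41]; [::1;21;34;19;38];
  [::1;23;51;24;48]; [::1;24;49;16;28]; [::1;26;40;20;47]; [::1;27;46;22;49];
  [::2;16;51;14;31]; [::2;17;49;14;35]; [::2;18;28;23;52]; [::2;20;41;17;32];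
  [::2;23;36;19;49]; [::2;24;36;26;41]; [::2;25;34;14;47]; [::3;13;39;27;51];
  [::3;16;40;15;45]; [::3;18;48;15;42]; [::3;20;49;27;36]; [::3;23;44;15;31];
  [::3;27;32;22;40]; [::4;14;28;26;30]; [::4;15;35;16;32]; [::4;16;33;24;41];
  [::4;17;38;25;51]; [::4;18;35;20;29]; [::4;20;36;21;28]; [::4;22;33;15;52];
  [::4;23;45;26;31]; [::4;25;30;22;43]; [::4;27;47;26;38]; [::5;13;36;17;39];
  [::5;15;50;22;47]; [::5;16;38;13;32]; [::5;17;50;24;42]; [::5;18;37;21;31];
  [::5;19;30;17;44]; [::5;21;32;23;50]; [::5;22;41;25;48]; [::5;23;39;24;43];
  [::5;24;37;16;36]; [::6;13;50;19;39]; [::6;16;41;23;43]; [::6;17;28;22;37];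
  [::6;18;45;24;32]; [::6;21;43;20;52]; [::6;22;42;27;44]; [::6;23;31;24;28];
  [::6;25;29;17;47]; [::6;26;51;17;33]; [::6;27;38;20;51]; [::7;14;30;16;29];
  [::7;17;52;18;41]; [::7;22;31;27;34]; [::7;26;35;22;38]; [::8;13;42;18;46];
  [::8;15;49;21;44]; [::8;17;37;13;31]; [::8;19;43;17;35]; [::8;23;47;21;30];
  [::8;24;40;23;49]; [::9;14;33;19;45]; [::9;15;37;23;38]; [::9;16;48;21;40];
  [::9;17;48;27;33]; [::9;19;44;25;49]; [::9;20;44;13;43]; [::9;23;35;13;28];
  [::9;25;40;17;42]; [::10;15;51;22;44]; [::10;16;43;14;38]; [::10;18;49;13;41];
  [::10;20;42;23;29]; [::10;21;42;19;32]; [::11;15;39;18;51];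
  [::11;16;47;18;30]; [::11;17;31;25;52]; [::11;18;40;19;28];
  [::11;20;33;26;44]; [::11;23;30;15;43]; [::11;25;39;16;50];
  [::12;15;41;21;38]; [::12;17;46;15;36]; [::12;18;43;25;42];
  [::12;19;52;26;34]; [::12;20;46;13;45]; [::12;21;45;14;46];
  [::12;24;46;23;48]; [::12;25;37;20;50]; [::12;26;32;20;31]; [::13;2;34;3;29];
  [::13;4;33;5;40]; [::13;7;47;11;34]; [::13;9;36;2;51]; [::13;10;36;0;52];
  [::13;11;45;7;30]; [::14;1;42;2;40]; [::14;2;33;11;36]; [::14;3;35;9;32];
  [::14;5;30;0;48]; [::14;6;50;9;39]; [::14;8;37;9;29]; [::14;10;31;11;37];
  [::14;11;29;6;41]; [::14;12;44;7;52]; [::15;0;43;10;47]; [::15;2;46;7;32];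
  [::15;3;39;2;29]; [::15;6;42;0;38]; [::15;7;39;0;28]; [::16;1;36;7;31];
  [::16;7;49;0;44]; [::16;12;32;11;46]; [::17;10;45;4;34]; [::18;0;31;6;34];
  [::18;8;41;3;50]; [::18;9;46;6;38]; [::19;2;38;11;35]; [::19;3;49;6;48];
  [::19;4;44;3;46]; [::19;6;40;10;51]; [::19;11;42;8;47]; [::20;5;52;12;30];
  [::20;6;35;10;34]; [::20;7;40;4;39]; [::20;8;39;10;28]; [::21;2;43;1;39];
  [::21;3;33;10;52]; [::21;4;35;7;33]; [::21;7;43;12;35]; [::21;8;38;5;46];
  [::21;9;48;4;50]; [::21;11;41;5;51]; [::22;2;45;1;29]; [::22;3;52;8;48];
  [::22;8;51;9;34]; [::22;9;30;6;45]; [::22;10;46;4;36]; [::22;12;40;11;39];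
  [::24;0;41;9;52]; [::24;3;32;8;29]; [::24;4;49;5;35]; [::24;9;47;3;38];
  [::24;10;50;2;44]; [::24;11;49;10;30]; [::25;0;45;8;50]; [::25;7;28;8;36];
  [::26;0;51;7;50]; [::26;2;30;3;43]; [::26;3;28;2;48]; [::26;4;47;12;49];
  [::26;5;28;12;39]; [::26;8;33;12;29]; [::26;9;31;1;46]; [::26;10;42;4;37];
  [::26;11;48;7;42]; [::27;2;37;12;41]; [::27;5;34;8;43]; [::27;7;37;5;29];
  [::27;8;40;0;37]; [::27;9;44;1;40]; [::27;10;37;1;50]; [::27;12;51;1;35];
  [::29;0;23;7;19]; [::30;1;22;11;27]; [::32;1;19;10;25]; [::36;6;24;7;18];
  [::37;3;17;0;19]; [::45;5;25;8;16]; [::48;3;25;1;20]; [::48;10;23;12;13]].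

Lemma decomposable_13_15_25 : decomposable 13 15 25.
Proof. by apply: (@certifies_decomposable _ _ _ walks_13_15_25); vm_compute. Qed.

Definition walks_23_15_25 : seq (seq nat) := [::
  [::0;25;45;29;47]; [::0;30;45;24;44]; [::0;33;38;26;60]; [::1;23;61;27;47];
  [::2;32;39;29;56]; [::3;32;60;24;43]; [::3;33;42;34;53]; [::3;35;57;32;45];
  [::3;36;62;31;61]; [::4;36;61;26;53]; [::5;24;40;30;41]; [::5;25;61;32;54];
  [::5;31;38;23;51]; [::6;31;52;35;40]; [::7;23;44;29;59]; [::8;29;57;30;43];
  [::9;26;49;27;56]; [::9;27;50;30;51]; [::9;28;62;33;49]; [::9;29;42;30;52];
  [::9;31;48;28;43]; [::10;24;57;26;46]; [::11;28;59;23;49]; [::11;31;45;36;55];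
  [::11;35;54;24;46]; [::12;28;47;30;59]; [::12;30;55;26;50];
  [::12;31;43;27;53]; [::12;33;50;37;42]; [::12;36;49;35;61];
  [::13;23;57;25;56]; [::13;25;44;37;43]; [::14;27;54;29;48];
  [::14;30;62;25;55]; [::14;34;60;33;54]; [::15;26;58;35;51];
  [::15;31;47;36;53]; [::15;33;52;24;48]; [::15;35;53;33;39];
  [::15;37;40;32;43]; [::16;24;41;37;46]; [::16;26;39;28;41];
  [::16;27;44;31;53]; [::16;28;45;27;57]; [::16;30;38;27;55];
  [::16;31;50;32;47]; [::16;32;52;29;50]; [::16;35;42;26;43];
  [::17;27;42;25;49]; [::17;37;55;29;53]; [::18;23;55;24;56];
  [::18;29;38;32;59]; [::18;34;46;28;50]; [::19;24;50;23;47];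
  [::20;31;56;28;57]; [::20;35;44;34;45]; [::21;25;38;35;55];
  [::22;33;41;31;49]; [::23;2;57;19;52]; [::23;4;51;14;45]; [::23;6;42;15;60];
  [::23;8;60;6;54]; [::23;9;39;3;46]; [::23;11;58;19;42]; [::23;12;46;4;62];
  [::23;16;44;14;53]; [::23;17;52;11;39]; [::23;19;55;8;56]; [::23;21;59;17;43];
  [::24;1;42;17;51]; [::24;2;47;21;38]; [::24;3;62;9;53]; [::24;4;52;7;42];
  [::24;9;40;16;39]; [::24;11;41;22;58]; [::24;14;58;16;62]; [::24;15;57;6;61];
  [::24;18;39;0;59]; [::24;22;40;12;47]; [::25;1;48;8;53]; [::25;2;54;12;51];
  [::25;4;50;20;46]; [::25;6;45;4;40]; [::25;9;38;10;60]; [::25;10;43;14;50];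
  [::25;16;49;4;41]; [::25;18;62;10;39]; [::25;22;39;2;52]; [::26;0;45;7;51];
  [::26;5;55;1;59]; [::26;7;48;17;62]; [::26;10;55;9;47]; [::26;11;53;1;41];
  [::26;12;41;10;54]; [::26;13;46;22;45]; [::26;17;39;7;40]; [::26;18;45;12;56];
  [::26;19;60;18;44]; [::26;22;44;13;52]; [::27;0;42;3;52]; [::27;5;40;19;51];
  [::27;6;43;19;41]; [::27;11;54;3;58]; [::27;13;45;21;62]; [::27;15;44;12;48];
  [::27;18;42;21;39]; [::27;22;60;3;40]; [::28;1;58;13;55]; [::28;3;47;13;40];
  [::28;5;46;8;44]; [::28;13;41;18;54]; [::28;15;38;7;60]; [::28;17;58;5;49];
  [::28;21;50;11;61]; [::29;0;50;6;49]; [::29;1;49;18;43]; [::29;2;61;4;60];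
  [::29;5;38;0;41]; [::29;11;43;0;58]; [::29;16;38;8;40]; [::29;17;38;19;62];
  [::29;19;46;1;61]; [::29;20;44;2;46]; [::30;4;54;7;46]; [::30;9;50;7;53];
  [::30;10;51;6;44]; [::30;11;62;0;48]; [::30;17;40;1;39]; [::30;21;53;6;56];
  [::30;22;62;7;61]; [::31;0;61;22;54]; [::31;1;44;11;51]; [::31;3;41;21;46];
  [::31;4;38;11;57]; [::31;8;61;20;55]; [::31;17;57;9;58]; [::31;19;50;2;60];
  [::31;21;48;19;59]; [::31;22;57;10;40]; [::32;1;50;15;62]; [::32;5;44;9;46];
  [::32;6;52;0;53]; [::32;7;55;3;49]; [::32;13;57;7;56]; [::32;14;39;13;51];
  [::32;15;52;8;58]; [::32;18;61;16;42]; [::32;19;49;20;41]; [::32;21;40;0;55];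
  [::33;1;38;18;57]; [::33;2;45;11;40]; [::33;4;43;21;51]; [::33;8;50;10;47];
  [::33;9;42;20;43]; [::33;11;48;6;59]; [::33;13;60;9;61]; [::33;16;60;17;56];
  [::33;17;55;2;48]; [::33;18;46;17;45]; [::33;19;61;15;55]; [::33;21;57;4;58];
  [::34;1;56;20;48]; [::34;3;38;12;55]; [::34;5;43;1;52]; [::34;6;58;10;49];
  [::34;7;41;8;57]; [::34;8;49;15;41]; [::34;11;42;22;51]; [::34;12;57;5;62];
  [::34;13;59;10;61]; [::34;15;59;2;43]; [::34;16;54;20;39]; [::34;19;53;2;38];
  [::34;22;47;5;56]; [::35;2;62;6;46]; [::35;5;45;10;56]; [::35;7;47;11;59];
  [::35;9;54;19;45]; [::35;14;62;20;60]; [::35;17;54;13;62]; [::35;18;51;2;41];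
  [::35;21;44;4;39]; [::36;0;49;14;52]; [::36;1;57;14;40]; [::36;2;49;12;58];
  [::36;5;50;3;48]; [::36;6;47;8;59]; [::36;7;44;17;50]; [::36;8;42;10;44];
  [::36;9;41;14;38]; [::36;10;53;20;51]; [::36;11;56;3;57]; [::36;13;61;17;41];
  [::36;14;61;21;54]; [::36;16;59;5;60]; [::36;17;47;15;46]; [::36;18;55;22;43];
  [::36;19;39;5;42]; [::36;20;38;6;39]; [::36;22;59;14;56]; [::37;1;45;8;39];
  [::37;2;42;14;60]; [::37;3;51;16;48]; [::37;5;53;13;49]; [::37;6;55;4;56];
  [::37;8;62;1;54]; [::37;9;45;16;52]; [::37;10;52;5;61]; [::37;11;60;12;62];
  [::37;12;52;18;47]; [::37;16;56;0;57]; [::37;18;40;15;45]; [::37;19;56;22;53];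
  [::37;20;52;22;38]; [::37;21;56;15;58]; [::37;22;48;9;59]; [::38;13;30;20;28];
  [::39;12;32;10;31]; [::40;2;27;20;23]; [::40;20;32;0;34]; [::41;6;30;5;23];
  [::42;4;37;7;28]; [::42;13;37;14;31]; [::43;7;31;13;35]; [::43;12;29;14;25];
  [::44;3;27;10;33]; [::44;19;30;8;32]; [::46;0;24;7;33]; [::46;14;26;4;27];
  [::47;4;32;11;25]; [::47;14;33;20;34]; [::47;20;25;12;35]; [::48;4;34;17;25];
  [::48;5;33;6;35]; [::48;10;28;22;23]; [::48;13;24;17;32]; [::48;18;28;6;26];
  [::49;7;25;15;30]; [::49;21;29;6;24]; [::50;13;29;22;35]; [::50;22;32;9;34];
  [::51;0;23;14;28]; [::51;1;35;10;29]; [::51;8;35;0;37]; [::52;21;27;19;28];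
  [::53;18;31;2;28]; [::54;0;28;8;25]; [::54;8;26;21;34]; [::54;15;29;3;30];
  [::58;2;26;3;25]; [::58;7;29;4;28]; [::58;18;30;2;34]; [::58;20;26;1;30];
  [::58;21;36;15;23]; [::59;3;23;10;34]; [::59;4;35;19;25]; [::59;20;24;8;27];
  [::60;1;27;7;30]; [::60;21;24;12;27]].

Lemma decomposable_23_15_25 : decomposable 23 15 25.
Proof. by apply: (@certifies_decomposable _ _ _ walks_23_15_25); vm_compute. Qed.

Definition walks_25_15_25 : seq (seq nat) := [::
  [::1;29;41;28;49]; [::1;30;40;31;63]; [::2;25;53;30;64]; [::2;27;51;32;53];
  [::2;30;44;38;59]; [::2;33;54;29;47]; [::3;32;54;30;61]; [::3;37;40;33;63];
  [::4;33;50;34;61]; [::5;25;50;38;57]; [::5;33;52;29;44]; [::6;25;44;36;54];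
  [::6;26;49;33;42]; [::6;31;57;27;60]; [::7;27;50;26;48]; [::8;32;43;39;51];
  [::8;35;62;32;61]; [::9;26;58;28;53]; [::9;30;51;31;42]; [::9;31;50;28;59];
  [::9;38;52;39;56]; [::10;28;42;39;60]; [::10;37;64;26;42]; [::12;27;47;38;55];
  [::12;29;60;38;51]; [::12;32;50;29;46]; [::14;31;49;39;41];
  [::15;30;48;32;41]; [::15;36;47;25;40]; [::17;28;55;33;51];
  [::17;33;53;27;44]; [::17;34;59;27;58]; [::17;36;63;25;57];
  [::17;37;55;39;63]; [::18;31;58;36;59]; [::19;29;56;26;62];
  [::19;34;64;35;52]; [::19;36;62;34;45]; [::20;35;58;30;41];
  [::21;25;43;27;52]; [::21;36;61;38;46]; [::22;28;45;25;49];
  [::22;29;62;33;58]; [::22;30;46;26;40]; [::22;33;56;27;42];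
  [::22;35;44;31;48]; [::22;38;49;35;60]; [::23;32;58;34;55];
  [::23;37;54;31;64]; [::24;30;60;28;40]; [::25;0;48;20;52]; [::25;1;53;5;61];
  [::25;4;59;5;64]; [::25;8;50;5;54]; [::25;12;62;18;55]; [::25;14;57;4;58];
  [::25;15;60;20;42]; [::25;17;60;11;46]; [::25;18;57;13;62];
  [::25;22;62;17;41]; [::26;2;62;6;61]; [::26;4;48;12;41]; [::26;5;43;9;44];
  [::26;8;49;5;60]; [::26;14;53;15;57]; [::26;15;58;3;43]; [::26;16;53;24;59];
  [::26;18;43;20;63]; [::26;19;49;14;47]; [::26;21;59;6;51]; [::26;23;46;24;52];
  [::27;0;57;10;55]; [::27;1;64;15;61]; [::27;3;50;14;54]; [::27;5;52;3;40];
  [::27;6;45;7;64]; [::27;8;58;5;45]; [::27;13;64;3;62]; [::27;14;43;15;63];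
  [::27;17;55;15;49]; [::27;20;57;2;46]; [::27;21;63;2;41]; [::27;24;60;9;48];
  [::28;0;51;1;61]; [::28;2;43;23;44]; [::28;3;59;19;51]; [::28;4;64;24;56];
  [::28;5;62;24;54]; [::28;6;48;3;57]; [::28;7;58;14;62]; [::28;9;63;10;47];
  [::28;11;43;17;46]; [::28;12;54;19;48]; [::28;13;54;10;52];
  [::28;19;55;22;63]; [::28;23;51;4;43]; [::29;2;45;15;48]; [::29;3;46;22;59];
  [::29;5;40;12;42]; [::29;6;56;0;55]; [::29;7;51;14;63]; [::29;10;41;22;57];
  [::29;14;59;11;53]; [::29;16;55;9;61]; [::29;17;40;10;51]; [::29;18;61;12;49];
  [::29;21;57;9;58]; [::29;24;42;1;43]; [::30;0;63;23;59]; [::30;3;53;21;47];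
  [::30;5;63;16;62]; [::30;8;62;7;49]; [::30;10;45;4;50]; [::30;13;41;19;42];
  [::30;14;42;4;63]; [::30;17;47;24;57]; [::30;19;46;4;55]; [::30;20;49;18;52];
  [::30;21;58;13;45]; [::31;0;64;17;61]; [::31;1;50;22;47]; [::31;2;48;18;45];
  [::31;3;51;5;56]; [::31;5;48;21;60]; [::31;7;61;14;55]; [::31;13;44;4;52];
  [::31;15;44;21;62]; [::31;19;61;0;59]; [::31;21;50;9;46]; [::31;24;55;5;41];
  [::32;0;45;12;59]; [::32;1;62;23;56]; [::32;2;56;13;55]; [::32;4;47;20;45];
  [::32;11;62;20;44]; [::32;15;47;7;40]; [::32;21;64;8;60]; [::32;22;64;11;63];
  [::33;1;56;16;59]; [::33;3;49;16;47]; [::33;8;40;6;64]; [::33;11;41;24;48];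
  [::33;13;50;7;44]; [::33;18;51;13;60]; [::33;20;51;21;61]; [::33;23;54;11;57];
  [::34;1;40;18;63]; [::34;2;58;19;47]; [::34;3;44;6;53]; [::34;5;46;1;44];
  [::34;6;50;2;49]; [::34;8;55;21;43]; [::34;9;40;21;56]; [::34;10;50;16;60];
  [::34;11;47;9;51]; [::34;12;56;17;42]; [::34;13;46;8;41]; [::34;15;56;7;57];
  [::34;18;53;8;52]; [::34;20;50;17;48]; [::34;22;52;0;54]; [::34;23;57;16;46];
  [::35;0;58;20;55]; [::35;2;52;16;45]; [::35;4;56;19;57]; [::35;10;61;22;51];
  [::35;12;58;6;47]; [::35;13;43;10;48]; [::35;14;44;12;53]; [::35;18;50;23;61];
  [::35;19;44;0;40]; [::35;23;49;21;42]; [::36;0;47;18;60]; [::36;2;55;7;43];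
  [::36;3;42;0;49]; [::36;4;54;22;45]; [::36;7;41;16;51]; [::36;8;42;18;56];
  [::36;9;52;1;55]; [::36;10;62;4;41]; [::36;12;47;8;48]; [::36;16;58;23;40];
  [::36;18;58;24;50]; [::36;20;59;15;46]; [::36;22;53;7;52]; [::36;23;60;12;64];
  [::36;24;49;4;53]; [::37;1;59;17;45]; [::37;2;61;24;51]; [::37;5;47;3;41];
  [::37;6;49;17;53]; [::37;7;54;1;47]; [::37;8;56;3;60]; [::37;9;45;24;44];
  [::37;11;44;10;58]; [::37;12;63;19;50]; [::37;14;52;13;61];
  [::37;15;54;16;42]; [::37;16;61;11;56]; [::37;18;41;1;57]; [::37;20;53;10;46];
  [::37;22;43;6;63]; [::37;24;63;13;48]; [::38;0;60;4;40]; [::38;1;48;11;58];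
  [::38;2;60;19;64]; [::38;3;54;8;43]; [::38;7;60;1;45]; [::38;12;50;11;42];
  [::38;15;42;13;53]; [::38;17;54;9;41]; [::38;18;44;16;48]; [::38;23;42;2;54];
  [::39;0;46;14;64]; [::39;2;51;15;62]; [::39;6;52;23;53]; [::39;8;45;14;40];
  [::39;9;49;13;47]; [::39;10;64;20;54]; [::39;11;55;6;46]; [::39;12;52;11;45];
  [::39;13;40;20;61]; [::39;19;40;2;44]; [::39;21;41;0;50]; [::39;22;44;8;57];
  [::40;11;36;14;34]; [::40;16;27;15;29]; [::41;6;32;7;33]; [::41;23;39;15;35];
  [::42;5;39;1;36]; [::42;7;34;24;32]; [::43;0;29;11;31]; [::43;12;33;0;37];
  [::43;16;34;21;35]; [::43;19;32;10;33]; [::43;24;38;4;30]; [::45;3;25;11;26];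
  [::45;21;28;8;29]; [::45;23;30;6;33]; [::46;7;30;16;33]; [::46;18;30;11;35];
  [::46;20;26;17;32]; [::47;23;27;18;32]; [::48;14;33;24;25]; [::48;23;29;4;39];
  [::49;10;27;9;32]; [::49;11;27;4;37]; [::50;15;28;24;35]; [::51;11;38;20;25];
  [::52;15;33;19;37]; [::52;17;39;20;32]; [::53;0;34;4;31]; [::53;19;27;22;26];
  [::54;18;39;24;26]; [::54;21;33;9;35]; [::55;3;35;1;26]; [::56;10;25;16;38];
  [::56;14;39;7;25]; [::56;20;31;12;30]; [::56;22;31;16;35]; [::57;6;36;5;32];
  [::57;12;26;13;36]; [::58;1;28;16;39]; [::59;7;26;3;39]; [::59;8;38;21;37];
  [::59;10;31;23;25]; [::59;13;38;5;35]; [::60;14;38;19;25]; [::62;0;26;10;38];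
  [::62;9;25;13;37]; [::63;7;35;6;38]; [::63;8;31;17;35]; [::64;9;29;20;28];
  [::64;16;32;13;29]; [::64;18;28;14;32]].

Lemma decomposable_25_15_25 : decomposable 25 15 25.
Proof. by apply: (@certifies_decomposable _ _ _ walks_25_15_25); vm_compute. Qed.

Definition walks_11_25_25 : seq (seq nat) := [::
  [::0;12;45;32;47]; [::0;15;48;26;52]; [::0;16;42;31;50]; [::0;17;54;34;53];
  [::0;18;47;29;40]; [::0;20;60;31;56]; [::0;21;40;32;49]; [::0;22;47;26;38];
  [::0;23;57;13;36]; [::0;24;50;17;45]; [::0;25;58;14;55]; [::0;26;60;12;59];
  [::0;30;54;27;57]; [::0;32;50;28;44]; [::0;33;49;26;46]; [::0;34;38;27;39];
  [::0;35;41;13;37]; [::1;11;47;34;45]; [::1;12;55;20;54]; [::1;13;39;33;59];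
  [::1;14;60;29;51]; [::1;15;58;21;41]; [::1;16;54;31;44]; [::1;17;57;12;36];
  [::1;20;36;21;43]; [::1;22;55;27;42]; [::1;23;40;30;58]; [::1;24;53;20;49];
  [::1;25;40;14;52]; [::1;26;41;11;50]; [::1;29;38;22;56]; [::1;30;59;23;53];
  [::1;32;55;28;40]; [::1;33;37;26;39]; [::1;34;40;15;38]; [::1;35;54;11;55];
  [::2;11;45;25;46]; [::2;13;46;16;50]; [::2;15;49;22;42]; [::2;16;36;30;49];
  [::2;17;41;20;59]; [::2;21;53;31;40]; [::2;22;52;19;58]; [::2;23;37;18;56];
  [::2;24;52;34;55]; [::2;25;38;12;48]; [::2;26;55;30;51]; [::2;27;37;19;53];
  [::2;28;57;35;37]; [::2;30;60;18;38]; [::2;31;58;11;43]; [::2;34;60;22;44];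
  [::2;35;50;15;54]; [::3;12;50;27;53]; [::3;13;56;27;60]; [::3;14;51;11;44];
  [::3;15;59;26;43]; [::3;16;60;19;51]; [::3;17;53;29;56]; [::3;20;51;17;59];
  [::3;21;49;14;47]; [::3;22;57;32;39]; [::3;23;48;35;55]; [::3;24;59;27;49];
  [::3;25;56;19;48]; [::3;28;38;17;36]; [::3;29;36;24;58]; [::3;30;41;24;57];
  [::3;31;57;18;54]; [::3;32;46;17;42]; [::3;33;42;30;52]; [::3;34;56;21;38];
  [::4;11;56;26;36]; [::4;13;49;25;43]; [::4;14;43;28;47]; [::4;15;36;34;39];
  [::4;16;40;11;48]; [::4;18;39;24;49]; [::4;19;36;11;57]; [::4;20;57;33;56];
  [::4;21;48;29;42]; [::4;22;36;33;50]; [::4;23;44;18;46]; [::4;24;37;16;44];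
  [::4;25;51;23;52]; [::4;26;42;11;38]; [::4;27;43;12;54]; [::4;29;50;18;55];
  [::4;32;41;33;51]; [::4;34;50;13;45]; [::4;35;40;22;53]; [::5;11;53;28;46];
  [::5;13;42;21;47]; [::5;14;45;16;52]; [::5;15;53;33;48]; [::5;16;49;18;40];
  [::5;19;44;30;53]; [::5;21;55;25;36]; [::5;22;39;19;38]; [::5;24;46;30;43];
  [::5;25;42;28;60]; [::5;26;54;33;45]; [::5;28;39;21;50]; [::5;29;52;28;54];
  [::5;30;50;26;57]; [::5;31;36;35;58]; [::5;32;48;13;55]; [::5;33;46;35;49];
  [::6;11;49;12;56]; [::6;12;42;14;41]; [::6;13;54;19;50]; [::6;14;59;25;48];
  [::6;16;39;30;47]; [::6;17;47;33;44]; [::6;18;43;35;39]; [::6;19;59;32;42];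
  [::6;20;44;17;40]; [::6;22;41;16;57]; [::6;24;60;23;55]; [::6;26;44;21;54];
  [::6;27;51;22;46]; [::6;28;58;17;43]; [::6;32;43;23;36]; [::6;33;60;13;53];
  [::6;34;37;12;58]; [::6;35;44;15;51]; [::7;11;39;23;49]; [::7;13;43;20;45];
  [::7;14;37;32;53]; [::7;15;41;28;59]; [::7;16;47;13;38]; [::7;17;48;27;41];
  [::7;18;53;25;57]; [::7;20;50;25;37]; [::7;22;58;27;36]; [::7;23;56;16;43];
  [::7;24;54;14;44]; [::7;25;39;17;52]; [::7;27;47;24;42]; [::7;29;43;31;39];
  [::7;30;37;31;55]; [::7;31;38;35;56]; [::7;32;51;13;58]; [::7;34;44;25;47];
  [::7;35;59;31;48]; [::8;11;37;20;47]; [::8;12;52;13;59]; [::8;14;39;29;55];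
  [::8;15;45;22;50]; [::8;16;59;34;51]; [::8;17;60;32;56]; [::8;18;45;23;54];
  [::8;20;42;19;45]; [::8;21;59;18;41]; [::8;22;37;21;57]; [::8;23;42;15;60];
  [::8;25;41;34;43]; [::8;27;46;29;44]; [::8;29;57;15;37]; [::8;30;45;24;40];
  [::8;31;46;19;49]; [::8;32;58;18;42]; [::8;33;58;26;53]; [::8;35;52;21;46];
  [::9;12;46;14;53]; [::9;15;47;23;41]; [::9;16;51;28;56]; [::9;17;55;16;48];
  [::9;20;56;15;43]; [::9;22;43;33;52]; [::9;23;46;20;40]; [::9;24;51;31;49];
  [::9;26;45;31;47]; [::9;27;40;33;55]; [::9;28;45;29;59]; [::9;29;49;34;46];
  [::9;30;56;14;38]; [::9;31;52;32;54]; [::9;33;38;30;57]; [::9;34;48;28;36];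
  [::9;35;53;12;39]; [::10;13;44;24;48]; [::10;14;48;20;39]; [::10;15;55;19;57];
  [::10;16;38;23;58]; [::10;17;56;24;55]; [::10;19;47;35;42];
  [::10;20;52;15;46]; [::10;24;38;32;36]; [::10;25;54;29;41];
  [::10;27;44;12;40]; [::10;29;58;16;53]; [::10;30;48;22;59];
  [::10;34;58;20;38]; [::10;35;45;21;60]; [::11;3;45;6;60]; [::11;9;44;5;59];
  [::12;5;42;9;51]; [::13;9;58;4;40]; [::14;9;37;1;57]; [::15;6;38;8;39];
  [::18;5;39;2;36]; [::19;0;54;10;43]; [::19;9;50;3;40]; [::21;9;60;7;51];
  [::24;8;58;0;43]; [::26;3;41;5;51]; [::27;0;60;2;45]; [::27;5;37;10;52];
  [::28;1;46;3;37]; [::28;4;59;6;49]; [::31;1;47;2;41]; [::32;9;45;10;44];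
  [::34;8;48;0;42]; [::35;5;56;10;51]; [::36;8;13;0;14]; [::37;4;30;6;29];
  [::37;6;23;5;17]; [::40;7;19;8;26]; [::41;0;29;2;19]; [::41;4;33;7;12];
  [::46;7;28;0;11]; [::47;10;33;2;12]; [::48;1;19;3;18]; [::49;10;12;4;17];
  [::50;7;26;10;23]; [::50;10;32;2;14]; [::51;0;31;10;18]; [::52;2;18;9;25];
  [::52;6;21;1;18]; [::52;8;28;10;11]; [::54;7;21;10;22]; [::57;2;20;5;34];
  [::60;1;27;3;35]; [::60;4;31;6;25]].

Lemma decomposable_11_25_25 : decomposable 11 25 25.
Proof. by apply: (@certifies_decomposable _ _ _ walks_11_25_25); vm_compute. Qed.

Definition walks_13_25_25 : seq (seq nat) := [::
  [::0;16;44;30;53]; [::0;18;59;15;57]; [::0;20;40;16;59]; [::0;22;50;21;49];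
  [::0;26;43;36;52]; [::0;27;53;22;56]; [::0;28;50;37;48]; [::0;29;61;22;39];
  [::0;32;62;30;55]; [::0;33;53;25;46]; [::0;34;49;26;50]; [::0;35;43;24;51];
  [::1;14;38;26;52]; [::1;15;40;32;61]; [::1;16;38;37;39]; [::1;17;54;22;60];
  [::1;18;41;36;59]; [::1;19;60;13;48]; [::1;23;61;34;58]; [::1;24;48;23;55];
  [::1;25;59;21;41]; [::1;26;59;31;57]; [::1;30;58;17;50]; [::1;31;60;26;47];
  [::1;32;54;28;53]; [::1;33;51;20;43]; [::1;34;43;17;45]; [::1;35;53;15;56];
  [::1;36;50;27;46]; [::2;15;46;36;60]; [::2;16;43;32;44]; [::2;18;56;27;51];
  [::2;19;51;14;57]; [::2;20;57;35;54]; [::2;21;47;22;43]; [::2;22;44;33;50];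
  [::2;23;53;19;56]; [::2;26;57;33;52]; [::2;28;46;24;47]; [::2;29;53;31;40];
  [::2;31;39;28;62]; [::2;33;55;21;61]; [::2;34;60;16;39]; [::2;35;39;24;53];
  [::2;36;44;28;58]; [::3;13;54;14;50]; [::3;14;41;37;42]; [::3;16;48;20;49];
  [::3;18;46;32;41]; [::3;20;59;13;51]; [::3;24;54;16;46]; [::3;25;43;33;47];
  [::3;26;58;22;59]; [::3;27;44;34;55]; [::3;28;55;16;57]; [::3;31;44;18;54];
  [::3;33;56;21;53]; [::3;35;62;21;52]; [::3;36;40;25;61]; [::3;37;62;20;44];
  [::4;13;38;15;39]; [::4;14;53;17;51]; [::4;15;54;26;46]; [::4;17;61;24;45];
  [::4;18;57;27;41]; [::4;21;51;28;42]; [::4;24;44;17;59]; [::4;27;42;30;43];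
  [::4;28;40;27;48]; [::4;30;38;34;40]; [::4;33;41;34;54]; [::4;34;48;17;60];
  [::4;36;58;32;47]; [::5;13;43;29;51]; [::5;15;55;24;40]; [::5;20;41;25;56];
  [::5;23;49;15;60]; [::5;25;57;34;42]; [::5;28;49;18;53]; [::5;31;54;37;61];
  [::5;33;45;14;39]; [::5;35;51;32;52]; [::5;36;54;23;38]; [::6;13;42;21;54];
  [::6;14;43;15;44]; [::6;15;52;17;40]; [::6;17;46;30;59]; [::6;18;39;17;47];
  [::6;20;50;34;56]; [::6;24;56;17;41]; [::6;26;51;18;50]; [::6;27;45;26;55];
  [::6;28;48;15;51]; [::6;29;55;13;53]; [::6;32;48;25;62]; [::6;33;60;18;42];
  [::6;34;47;20;46]; [::6;35;52;14;60]; [::6;37;56;29;38]; [::7;14;42;35;56];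
  [::7;16;45;18;38]; [::7;17;38;21;39]; [::7;18;55;37;43]; [::7;19;52;37;49];
  [::7;21;48;33;62]; [::7;23;51;31;55]; [::7;25;44;14;40]; [::7;27;47;35;60];
  [::7;29;50;31;48]; [::7;30;45;20;53]; [::7;33;54;29;52]; [::7;34;59;19;45];
  [::7;35;58;27;61]; [::7;37;45;21;44]; [::8;13;41;19;46]; [::8;15;41;26;39];
  [::8;18;61;19;49]; [::8;20;61;28;59]; [::8;21;46;33;58]; [::8;23;42;25;55];
  [::8;24;50;30;61]; [::8;30;49;25;51]; [::8;32;38;24;62]; [::8;34;62;31;56];
  [::8;37;47;28;41]; [::9;13;40;26;61]; [::9;14;61;36;53]; [::9;18;47;23;60];
  [::9;19;43;23;46]; [::9;23;39;36;56]; [::9;24;59;35;49]; [::9;25;58;15;45];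
  [::9;27;55;35;41]; [::9;28;43;18;48]; [::9;29;57;37;58]; [::9;30;52;13;44];
  [::9;31;42;19;40]; [::9;32;42;17;55]; [::9;33;61;13;39]; [::9;34;39;30;57];
  [::9;35;38;25;50]; [::10;19;57;23;50]; [::10;21;60;27;52]; [::10;22;42;20;38];
  [::10;23;59;29;48]; [::10;24;58;29;49]; [::10;27;59;32;57];
  [::10;28;45;32;56]; [::10;30;56;13;62]; [::10;31;49;22;41];
  [::10;32;60;37;44]; [::10;33;38;36;47]; [::10;34;46;29;40];
  [::10;36;45;29;60]; [::10;37;53;16;51]; [::11;13;57;24;49];
  [::11;14;47;31;58]; [::11;16;41;23;45]; [::11;18;58;13;47];
  [::11;19;50;16;61]; [::11;20;54;27;43]; [::11;22;45;25;39];
  [::11;23;62;18;52]; [::11;25;60;24;41]; [::11;27;38;22;51];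
  [::11;32;50;35;40]; [::11;34;52;28;56]; [::11;35;61;31;38];
  [::12;13;50;15;62]; [::12;17;62;22;55]; [::12;18;40;30;41];
  [::12;19;38;28;57]; [::12;20;52;22;48]; [::12;21;40;33;49];
  [::12;23;58;20;60]; [::12;24;42;16;47]; [::12;25;52;23;56];
  [::12;26;56;20;39]; [::12;27;49;13;45]; [::12;29;62;14;46];
  [::12;31;45;34;51]; [::12;32;49;16;58]; [::12;33;39;19;54];
  [::12;34;53;26;44]; [::12;35;46;31;43]; [::14;0;61;6;48]; [::14;2;46;11;59];
  [::14;8;53;4;56]; [::14;10;45;2;49]; [::15;9;54;0;42]; [::15;12;53;10;61];
  [::16;6;49;4;62]; [::16;8;42;9;52]; [::16;9;62;3;56]; [::17;0;60;8;57];
  [::17;3;45;5;49]; [::19;5;43;9;47]; [::19;8;38;4;44]; [::20;7;57;4;55];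
  [::22;3;38;0;40]; [::22;5;58;6;57]; [::22;8;54;7;46]; [::23;3;40;1;44];
  [::23;4;61;12;40]; [::25;0;41;5;54]; [::26;4;50;12;42]; [::26;8;50;5;62];
  [::27;2;38;1;62]; [::27;8;52;6;39]; [::28;7;58;3;60]; [::29;3;43;0;44];
  [::29;10;42;2;41]; [::29;11;54;1;42]; [::30;12;38;9;51]; [::35;10;43;8;45];
  [::36;6;45;0;62]; [::36;7;50;11;57]; [::36;8;44;11;48]; [::37;9;59;7;51];
  [::37;12;59;5;46]; [::39;3;32;4;29]; [::39;10;18;5;32]; [::40;8;29;5;37];
  [::41;7;15;0;31]; [::42;7;31;11;36]; [::42;11;28;8;33]; [::43;6;23;0;21];
  [::44;5;17;8;35]; [::46;10;25;2;13]; [::47;0;37;4;25]; [::47;5;26;10;15];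
  [::47;7;13;1;29]; [::47;8;25;6;30]; [::48;2;17;9;26]; [::48;3;34;5;30];
  [::48;5;21;6;19]; [::48;8;31;4;35]; [::49;1;22;9;36]; [::51;1;28;12;36];
  [::52;4;22;6;31]; [::52;12;22;7;24]; [::53;11;26;7;32]; [::54;10;17;11;30];
  [::55;2;30;0;36]; [::55;5;16;12;14]; [::55;10;13;0;19]; [::55;11;24;2;32];
  [::57;5;27;1;21]; [::58;0;24;5;14]; [::58;4;20;9;21]; [::58;10;16;4;19];
  [::59;2;37;11;33]; [::59;10;20;1;37]; [::60;11;15;3;30]; [::62;11;21;3;19]].

Lemma decomposable_13_25_25 : decomposable 13 25 25.
Proof. by apply: (@certifies_decomposable _ _ _ walks_13_25_25); vm_compute. Qed.

Lemma decomposable_5_5 : {in [:: 3; 5; 7; 9], forall w, decomposable w 5 5}.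
Proof.
move=> w; rewrite !inE => /or4P[] /eqP->.
- exact: decomposable_3_5_5.
- exact: decomposable_5_5_5.
- exact: decomposable_7_5_5.
exact: decomposable_9_5_5.
Qed.

Lemma decomposable_5n_5n (ws : seq nat) :
    {subset ws <= [:: 3; 5; 7; 9]} ->
  decomposable (sumn ws) (5 * size ws) (5 * size ws).
Proof.
move=> ws_sub; rewrite -sumn_nseq.
apply: (@latin_composition (size ws)); rewrite ?size_nseq //.
move=> a b c /ws_sub a_w /nseqP[-> _] /nseqP[-> _]; exact: decomposable_5_5.
Qed.

Lemma decomposable_blocks :
  {in [:: 11; 13; 23; 25] & [:: 15; 25] & [:: 15; 25],
    forall a b c, decomposable a b c}.
Proof.
have K15 a ws : sumn ws = a -> size ws = 3 ->
    all [in [:: 3; 5; 7; 9]] ws -> decomposable a 15 15.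
  by move=> <- sz3 /allP/decomposable_5n_5n; rewrite sz3.
have K25 a ws : sumn ws = a -> size ws = 5 ->
    all [in [:: 3; 5; 7; 9]] ws -> decomposable a 25 25.
  by move=> <- sz5 /allP/decomposable_5n_5n; rewrite sz5.
have K15_25 : {in [:: 11; 13; 23; 25], forall a, decomposable a 15 25}.
  move=> a; rewrite !inE => /or4P[] /eqP->.
  - exact: decomposable_11_15_25.
  - exact: decomposable_13_15_25.
  - exact: decomposable_23_15_25.
  exact: decomposable_25_15_25.
move=> a b c a_in; rewrite !inE => /orP[] /eqP-> /orP[] /eqP->.
- move: a_in; rewrite !inE => /or4P[] /eqP->.
  + exact: (K15 _ [:: 3; 3; 5]).
  + exact: (K15 _ [:: 3; 5; 5]).
  + exact: (K15 _ [:: 7; 7; 9]).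
  exact: (K15 _ [:: 7; 9; 9]).
- exact: K15_25.
- exact/decomposable_swap/K15_25.
move: a_in; rewrite !inE => /or4P[] /eqP->.
- exact: decomposable_11_25_25.
- exact: decomposable_13_25_25.
- exact: (K25 _ [:: 3; 5; 5; 5; 5]).
exact: (K25 _ [:: 5; 5; 5; 5; 5]).
Qed.

(** * The given range *)

Lemma odd_five_parts (r : nat) : odd r -> 55 <= r <= 125 ->
  exists rs, [/\ size rs = 5, sumn rs = r & {subset rs <= [:: 11; 13; 23; 25]}].
Proof.
move=> odd_r /andP[ge_r le_r].
pose parts u := mkseq (fun i => 11 + 12 * (i < u %/ 6) + 2 * (i < u %% 6)) 5.
have partsP : all (fun u => sumn (parts u) == 55 + u.*2) (iota 0 36) by [].
exists (parts (r - 55)./2); split; first by rewrite size_mkseq.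
  have /eqP-> : sumn (parts (r - 55)./2) == 55 + (r - 55)./2.*2.
    apply: (allP partsP); rewrite mem_iota /= add0n ltn_half_double ltnS.
    by rewrite leq_subLR (leq_trans le_r).
  by rewrite even_halfK ?subnKC // oddB // odd_r.
move=> _ /mapP[i _ ->].
by case: (_ < _); case: (_ < _).
Qed.

Lemma five_parts_15_25 (s : nat) : s \in [:: 75; 85; 95; 105; 115; 125] ->
  exists ss, [/\ size ss = 5, sumn ss = s & {subset ss <= [:: 15; 25]}].
Proof.
pose parts k := nseq k 25 ++ nseq (5 - k) 15.
have sub k : {subset parts k <= [:: 15; 25]}.
  by move=> x; rewrite mem_cat => /orP[] /nseqP[-> _].
have ex k : k <= 5 -> sumn (parts k) = s ->
    exists ss, [/\ size ss = 5, sumn ss = s & {subset ss <= [:: 15; 25]}].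
  by move=> le_k5 <-; exists (parts k); rewrite size_cat !size_nseq subnKC.
rewrite !inE => /or4P[||| /or3P[]] /eqP def_s.
- exact: (ex 0).
- exact: (ex 1).
- exact: (ex 2).
- exact: (ex 3).
- exact: (ex 4).
exact: (ex 5).
Qed.

Theorem theorem4p10 (r s t : nat)
    (odd_r : odd r) (odd_s : odd s) (odd_t : odd t)
    (r_range : 55 <= r <= 125)
    (s_range : s \in [:: 75; 85; 95; 105; 115; 125])
    (t_range : t \in [:: 75; 85; 95; 105; 115; 125])
    (nec : necessary_conditions r s t) :
  has_5cycle_decomposition (complete_tripartite r s t).
Proof.
have [rs [size_rs <- rsP]] := odd_five_parts odd_r r_range.
have [ss [size_ss <- ssP]] := five_parts_15_25 s_range.
have [ts [size_ts <- tsP]] := five_parts_15_25 t_range.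
apply/decomposable_tripartite/(latin_composition size_rs size_ss size_ts).
by move=> a b c /rsP a_in /ssP b_in /tsP c_in; apply: decomposable_blocks.
Qed.
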